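(* Let $G$ be a simple connected graph with $n$ vertices and $m$ edges, let $k\ge 1$ be an integer, and let $S_k(G)$ be the $k$-parallel subdivision graph of $G$. Put $f_1(x)=\frac{2+\sqrt{4-2x}}{2}$ and $f_2(x)=\frac{2-\sqrt{4-2x}}{2}$. Then the eigenvalues of the normalized Laplacian $\mathscr{L}(S_k(G))$ are as follows. (i) If $\lambda\notin\{0,2\}$ is an eigenvalue of $\mathscr{L}(G)$, then $f_1(\lambda)$ and $f_2(\lambda)$ are eigenvalues of $\mathscr{L}(S_k(G))$, and each of them has the same multiplicity as $\lambda$ has in $\mathscr{L}(G)$. (ii) $0$ and $2$ are eigenvalues of $\mathscr{L}(S_k(G))$, each of multiplicity $1$. (iii) $1$ is an eigenvalue of $\mathscr{L}(S_k(G))$; its multiplicity is $km-n+2$ if $G$ is bipartite and $km-n$ otherwise.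
   Context: For a graph $H$ with adjacency matrix $A(H)$ and diagonal degree matrix $D(H)$ (no isolated vertices), the normalized Laplacian is $\mathscr{L}(H)=I-D(H)^{-1/2}A(H)D(H)^{-1/2}$, i.e. its $(i,i)$ entry is $1$, its $(i,j)$ entry is $-1/\sqrt{d(i)d(j)}$ if $i\sim j$, and $0$ otherwise. The $k$-parallel subdivision graph $S_k(G)$ is obtained from $G$ by replacing each edge $uv$ of $G$ by $k$ internally disjoint paths $u-w-v$ of length $2$ (each with its own new middle vertex $w$); thus $S_k(G)$ has $n+km$ vertices and $2km$ edges, each vertex $u\in V(G)$ has degree $k\,d_G(u)$ and each new vertex has degree $2$.
   Formalization: In (iii) only the multiplicity formula for 1 is stated, not that 1 is always an eigenvalue: this fails when km−n=0 with G non-bipartite, e.g. G a triangle and k=1, where S_1(G) is the 6-cycle; G is also taken with n≥2, so that the normalized Laplacian is defined. *)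

(* Defs.v *)
From HB Require Import structures.
From mathcomp Require Import all_boot all_order all_algebra.
From mathcomp Require Import reals.
Set Implicit Arguments. Unset Strict Implicit. Unset Printing Implicit Defensive.
Import Order.TTheory GRing.Theory Num.Theory.
Local Open Scope ring_scope.

Definition simple_graph (T : finType) (adj : rel T) : Prop :=
  symmetric adj /\ irreflexive adj.

Definition connected_graph (T : finType) (adj : rel T) : Prop :=
  forall x y : T, connect adj x y.

Definition bipartite (T : finType) (adj : rel T) : bool :=
  [exists c : {ffun T -> bool}, [forall x, forall y, adj x y ==> (c x != c y)]].

Definition edge_set (T : finType) (adj : rel T) : {set {set T}} :=
  [set e : {set T} | [exists x, exists y, adj x y && (e == [set x; y])]].

Definition edge_type (T : finType) (adj : rel T) :=
  {e : {set T} | e \in edge_set adj}.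

Definition nedges (T : finType) (adj : rel T) : nat := #|edge_set adj|.

Definition subdiv_type (T : finType) (adj : rel T) (k : nat) : finType :=
  (T + (edge_type adj * 'I_k))%type.

Definition subdiv_adj (T : finType) (adj : rel T) (k : nat)
  : rel (subdiv_type adj k) :=
  fun a b =>
    match a, b with
    | inl u, inr w => u \in val w.1
    | inr w, inl u => u \in val w.1
    | _, _ => false
    end.

Arguments subdiv_adj [T] adj k.

Definition degR (R : realType) (T : finType) (adj : rel T) (x : T) : R :=
  (#|[set y | adj x y]|)%:R.

Definition nlap (R : realType) (T : finType) (adj : rel T) : 'M[R]_#|T| :=
  \matrix_(i, j)
    (if i == j then 1 else
       if adj (enum_val i) (enum_val j)
       then - (Num.sqrt (degR R adj (enum_val i) * degR R adj (enum_val j)))^-1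
       else 0).

Definition eig_mult (R : realType) (n : nat) (M : 'M[R]_n) (a : R) : nat :=
  mup a (char_poly M).

Definition f1 (R : realType) (x : R) : R := (2 + Num.sqrt (4 - 2 * x)) / 2.
Definition f2 (R : realType) (x : R) : R := (2 - Num.sqrt (4 - 2 * x)) / 2.

(* Main.v *)
Require Import Defs.
From HB Require Import structures.
From mathcomp Require Import all_boot all_order all_algebra.
From mathcomp Require Import perm reals ring lra.
Set Implicit Arguments. Unset Strict Implicit. Unset Printing Implicit Defensive.
Import Order.TTheory GRing.Theory Num.Theory.
Local Open Scope ring_scope.

(** Ordering the vertices of [S_k(G)] as old ones followed by midpoints, its
    normalized Laplacian is [[1, -B], [-B^T, 1]] with [B B^T = 1 - L(G)/2].
    Taking the determinant of [X - L(S_k(G))] by blocks gives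
      chi_S (X - 1)^n = (-1/2)^n chi_G(2 - 2 (X - 1)^2) (X - 1)^(km),
    and [f1 lam], [f2 lam] are the two solutions of [2 - 2 (x - 1)^2 = lam].
    These are simple points of the substitution unless [x = 1], where it
    doubles multiplicities. It remains to know the multiplicities of 0 and 2
    in [L(G)]: by the energy identity an eigenvector for [1 - eps], with
    [eps = 1] or [-1], is after rescaling by square roots of degrees a
    function with [g u = eps * g v] along every edge, hence unique up to a
    scalar in a connected graph. *)

(** * Block determinant identities over a commutative ring *)

Section BlockDeterminants.
Variables (R : comNzRingType) (m n : nat).
Implicit Types (B : 'M[R]_(m, n)) (C : 'M[R]_(n, m)) (y : R).

(** Column elimination of the lower left block, with [y] multiplied in rather than inverted: later
    [y] is the polynomial [X - 1]. *)
Lemma det_block_scalar B C y :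
  \det (block_mx y%:M B C y%:M) * y ^+ m = \det ((y * y)%:M - B *m C) * y ^+ n.
Proof.
have /(congr1 determinant) : block_mx y%:M B C y%:M *m block_mx y%:M 0 (- C) 1%:M =
    block_mx ((y * y)%:M - B *m C) B 0 y%:M.
  rewrite mulmx_block !mulmx0 !add0r !mulmx1 !mulmxN mul_scalar_mx mul_mx_scalar.
  by rewrite mul_scalar_mx scale_scalar_mx subrr.
by rewrite det_mulmx det_lblock det_ublock det1 mulr1 !det_scalar.
Qed.

(** Sylvester's identity: the matrix [[[y, B], [C, 1]]] is made block triangular in two ways, by
    clearing [C] or by clearing [B]. *)
Lemma det_scalar_sub_mulmxC B C y :
  y ^+ n * \det (y%:M - B *m C) = y ^+ m * \det (y%:M - C *m B).
Proof.
have /(congr1 determinant) : block_mx y%:M B C 1%:M *m block_mx 1%:M 0 (- C) 1%:M =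
    block_mx (y%:M - B *m C) B 0 1%:M.
  by rewrite mulmx_block !mulmx0 !add0r !mulmx1 !mulmxN mul1mx subrr.
rewrite det_mulmx det_lblock det_ublock !det1 !mulr1 => <-.
have /(congr1 determinant) : block_mx y%:M B C 1%:M *m block_mx 1%:M (- B) 0 y%:M =
    block_mx y%:M 0 C (y%:M - C *m B).
  rewrite mulmx_block !mulmx0 !addr0 !mulmx1 !mulmxN mul1mx mul_scalar_mx.
  by rewrite mul_mx_scalar addNr addrC.
by rewrite det_mulmx det_lblock det_ublock det1 mul1r !det_scalar mulrC.
Qed.

End BlockDeterminants.

(** * Root multiplicities under polynomial substitution *)

Section RootMultiplicity.
Variable F : fieldType.
Implicit Types (p q : {poly F}) (a : F).

Lemma mup_split p a : p != 0 ->
  exists2 r, ~~ root r a & p = r * ('X - a%:P) ^+ mup a p.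
Proof.
move=> p0; have [j [r]] := multiplicity_XsubC p a.
rewrite p0 /= => ra Ep; exists r => //.
by rewrite {2}Ep mupMr // mup_XsubCX eqxx.
Qed.

(** Substituting [q] into [p = r * (X - q(a))^m] turns the power into [(s * (X - a)^j)^m], while the
    cofactor keeps the nonzero value [r(q(a))] at [a]. *)
Lemma mup_comp p q s a j : p != 0 -> ~~ root s a ->
  q - q.[a]%:P = s * ('X - a%:P) ^+ j -> mup a (p \Po q) = (j * mup q.[a] p)%N.
Proof.
move=> p0 sa Eq; have [r ra Ep] := mup_split q.[a] p0.
rewrite {1}Ep comp_polyM rmorphXn /= comp_polyB comp_polyX comp_polyC Eq.
rewrite exprMn -exprM mulrA mupMr ?mup_XsubCX ?eqxx //.
by rewrite rootM negb_or /root horner_comp ra horner_exp expf_neq0.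
Qed.

Lemma mup_char_poly_gt0 n (M : 'M[F]_n) a :
  (0 < mup a (char_poly M))%N = eigenvalue M a.
Proof.
rewrite eigenvalue_root_char -XsubC_dvd ?dvdp_XsubCl //.
exact/monic_neq0/char_poly_monic.
Qed.

End RootMultiplicity.

(** * Characteristic polynomials: reindexing and simple eigenvalues *)

Lemma char_poly_reindex (R : comNzRingType) m n (f : 'I_m -> 'I_n) (A : 'M[R]_n) :
  bijective f -> char_poly (mxsub f f A) = char_poly A.
Proof.
(* The two sizes are equal but need not be convertible; once identified, [f] is a permutation, whose
   sign enters twice. *)
move=> bf; have Emn : m = n by have := bij_eq_card bf; rewrite !card_ord.
subst m; pose s := perm (bij_inj bf).
have -> : mxsub f f A = row_perm s (col_perm s A).
  by apply/matrixP=> i j; rewrite !mxE !permE.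
rewrite /char_poly.
have -> : char_poly_mx (row_perm s (col_perm s A)) =
    row_perm s (col_perm s (char_poly_mx A)).
  by apply/matrixP=> i j; rewrite !mxE (inj_eq perm_inj).
rewrite row_permE col_permE !det_mulmx !det_perm mulrCA mulrC odd_permV.
by rewrite -signr_addb addbb expr0 mul1r.
Qed.

Lemma rdot_eq0 (R : realDomainType) n (v : 'rV[R]_n) :
  ((v *m v^T) ord0 ord0 == 0) = (v == 0).
Proof.
apply/eqP/eqP => [|->]; last by rewrite mul0mx mxE.
rewrite mxE; under eq_bigr do rewrite mxE -expr2.
move/psumr_eq0P => H; apply/rowP=> i; rewrite mxE.
by apply/eqP; rewrite -sqrf_eq0; apply/eqP/H => // j _; exact: sqr_ge0.
Qed.

(* Deflation: replacing [M] by [M + v^T v] moves the eigenvalue [a] of the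
   eigenvector [v] to [a + |v|^2] and leaves the rest of the spectrum alone. *)
Lemma mup_char_poly_simple (R : realFieldType) n (M : 'M[R]_n) a (v : 'rV[R]_n) :
  M^T = M -> v != 0 -> v *m M = a *: v ->
  (forall w : 'rV[R]_n, w *m M = a *: w -> exists c, w = c *: v) ->
  mup a (char_poly M) = 1%N.
Proof.
move=> symM v0 vM kerM.
have Mv : M *m v^T = a *: v^T by rewrite -{1}symM -trmx_mul vM linearZ.
set s := (v *m v^T) ord0 ord0; have s0 : s != 0 by rewrite rdot_eq0.
pose M' := M + v^T *m v; pose y : {poly R} := 'X - a%:P.
pose pv : 'rV_n := map_mx polyC v; pose W : 'M_n := pv^T *m pv.
have y0 : y != 0 by rewrite polyXsubC_eq0.
have EM' : char_poly_mx M' = char_poly_mx M - W.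
  by rewrite /char_poly_mx /M' map_mxD map_mxM -map_trmx opprD addrA.
have CW : char_poly_mx M *m W = y *: W.
  rewrite /char_poly_mx mulmxBl mul_scalar_mx /W /pv mulmxA map_trmx -(map_mxM _ M) Mv.
  by rewrite map_mxZ -scalemxAl -scalerBl.
(* The columns of [W] are eigenvectors of [M], so the rank-one update factors out. *)
have E1 : char_poly_mx M *m (y%:M - W) = y *: char_poly_mx M'.
  by rewrite mulmxBr CW mul_mx_scalar EM' -scalerBr.
move/(congr1 determinant): E1; rewrite det_mulmx detZ => E1.
(* Sylvester's identity reduces this determinant to a 1 by 1 one; the extra factor [y] avoids the
   exponent [n - 1]. *)
have E2 : y * \det (y%:M - W) = y ^+ n * (y - s%:P).
  rewrite -[X in X * _]expr1 (det_scalar_sub_mulmxC pv^T pv).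
  have -> : pv *m pv^T = s%:P%:M.
    by rewrite /pv map_trmx -map_mxM [v *m _]mx11_scalar map_scalar_mx.
  by rewrite -raddfB det_scalar1.
have E : char_poly M * (y - s%:P) = y * char_poly M'.
  apply: (mulfI (expf_neq0 n y0)); rewrite mulrCA -E2 mulrCA.
  by rewrite /char_poly E1 mulrCA.
(* Multiplying [w M' = a w] by [v^T] shows that [w] is orthogonal to [v]; then [w] is an eigenvector
   of [M], hence a multiple of [v], hence zero. *)
have aM' : ~~ root (char_poly M') a.
  rewrite -eigenvalue_root_char; apply/negP => /eigenvalueP[w wM' w0].
  have wv : w *m v^T = 0.
    have := congr1 (mulmx^~ v^T) wM'.
    rewrite /M' mulmxDr mulmxDl -mulmxA Mv -scalemxAr -scalemxAl.
    move/(canRL (addKr _)); rewrite addNr -!mulmxA [v *m _]mx11_scalar -/s.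
    by rewrite mul_mx_scalar -scalemxAr => /eqP; rewrite scaler_eq0 (negbTE s0) => /eqP.
  have wM : w *m M = a *: w by rewrite -wM' mulmxDr mulmxA wv mul0mx addr0.
  have [c Ew] := kerM w wM; move/eqP: wv w0.
  rewrite Ew -scalemxAl scaler_eq0 => /orP[/eqP->|]; first by rewrite scale0r eqxx.
  by move=> /eqP Z; move: s0; rewrite /s Z mxE eqxx.
have ys : ~~ root (y - s%:P) a.
  by rewrite /root !hornerE subrr add0r oppr_eq0.
by rewrite -(mupMl _ ys) E mupMl // -[y]expr1 mup_XsubCX eqxx.
Qed.

(** * Extremal eigenvalues of the normalized Laplacian of a connected graph *)

Section NormalizedLaplacian.
Variables (R : realType) (V : finType) (adj : rel V).
Hypotheses (simple_adj : simple_graph adj) (conn_adj : connected_graph adj).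
Hypothesis V_gt1 : (1 < #|V|)%N.
Local Notation d := (degR R adj).
Local Notation L := (nlap R adj).
Implicit Types (g s : V -> R) (u v : V) (mu eps : R).

Let symA : symmetric adj := simple_adj.1.
Let irrA : irreflexive adj := simple_adj.2.

(** A path from [u] to a second vertex begins with an edge at [u]. *)
Lemma degR_gt0 u : 0 < d u.
Proof.
rewrite ltr0n; have [v vu] : exists v, v != u.
  move: V_gt1; rewrite (cardD1 u) inE add1n ltnS => /card_gt0P[v].
  by rewrite !inE => /andP[]; exists v.
have /connectP[[|z p] /= puv Ev] := conn_adj u v; first by rewrite Ev eqxx in vu.
by apply/card_gt0P; exists z; rewrite inE; case/andP: puv.
Qed.

Lemma connected_eq (T : Type) (h : V -> T) :
  (forall u v, adj u v -> h u = h v) -> forall u v, h u = h v.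
Proof.
move=> hE u v; have /connectP[p] := conn_adj u v.
by elim: p u => [u _ ->|z p IH u /= /andP[/hE -> pz]] //; exact: IH.
Qed.

Let sd u := Num.sqrt (d u).

Let sd_gt0 u : 0 < sd u.
Proof. by rewrite sqrtr_gt0 degR_gt0. Qed.

Let sd2 u : sd u * sd u = d u.
Proof. by rewrite -expr2 sqr_sqrtr // ltW // degR_gt0. Qed.

Lemma nlap_entry i j :
  L i j = (i == j)%:R - (adj (enum_val i) (enum_val j))%:R /
            (Num.sqrt (d (enum_val i)) * Num.sqrt (d (enum_val j))).
Proof.
rewrite mxE; have [->|_] := eqVneq i j; first by rewrite irrA mul0r subr0.
case: ifP => _; last by rewrite mul0r subr0.
by rewrite sqrtrM ?ler0n // sub0r mul1r.
Qed.

Lemma nlap_sym : L^T = L.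
Proof.
apply/matrixP=> i j; rewrite mxE !nlap_entry eq_sym symA.
by congr (_ - _ / _); rewrite mulrC.
Qed.

(** The substitution [w = D^(1/2) g], which frees the eigenvector equation of square roots. *)
Definition weighted_row g : 'rV[R]_#|V| :=
  \row_i (g (enum_val i) * Num.sqrt (d (enum_val i))).

Lemma weighted_rowP w : exists g, w = weighted_row g.
Proof.
exists (fun u => w 0 (enum_rank u) / sd u); apply/rowP=> i.
by rewrite mxE enum_valK divfK // gt_eqF ?sd_gt0.
Qed.

Lemma weighted_row_eq0 g : (weighted_row g == 0) = [forall u, g u == 0].
Proof.
apply/eqP/forallP => [/rowP w0 u|g0]; last first.
  by apply/rowP=> i; rewrite !mxE (eqP (g0 _)) mul0r.
have /eqP := w0 (enum_rank u); rewrite !mxE enum_rankK mulf_eq0.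
by rewrite (gt_eqF (sd_gt0 u)) orbF.
Qed.

(** The weight of [g u] cancels one root in each entry of [L]; multiplying the equation at [v] by
    the root of [d v] leaves [A g = (1 - mu) D g]. *)
Lemma weighted_row_nlap g mu :
  weighted_row g *m L = mu *: weighted_row g <->
  (forall v, \sum_(u | adj v u) g u = (1 - mu) * d v * g v).
Proof.
have E j : (weighted_row g *m L) 0 j = g (enum_val j) * sd (enum_val j) -
    (\sum_(u | adj (enum_val j) u) g u) / sd (enum_val j).
  rewrite mxE; under eq_bigr do rewrite nlap_entry mxE mulrBr.
  rewrite sumrB (bigD1 j) //= eqxx mulr1 big1 ?addr0; last first.
    by move=> i /negbTE ->; rewrite mulr0.
  congr (_ - _); rewrite mulr_suml [RHS]big_mkcond /=.
  rewrite [RHS](reindex (@enum_val V V)) /=; last exact/onW_bij/enum_val_bij.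
  apply: eq_bigr => i _; rewrite [in RHS]symA; case: (adj _ _); last first.
    by rewrite mul0r mulr0.
  by rewrite mul1r invfM mulrA mulfK // gt_eqF ?sd_gt0.
split=> [/rowP eig v|eig].
  have := eig (enum_rank v); rewrite E !mxE enum_rankK -/(sd v) => H.
  apply: (mulIf (invr_neq0 (lt0r_neq0 (sd_gt0 v)))).
  rewrite -sd2; move: H; have := lt0r_neq0 (sd_gt0 v); move: (\sum_(_ | _) _).
  move=> S sv0 H; have -> : S / sd v = g v * sd v - mu * (g v * sd v).
    by rewrite -H opprB addrC subrK.
  by field.
apply/rowP=> j; rewrite E mxE eig mxE -/(sd _) -sd2.
by have := lt0r_neq0 (sd_gt0 (enum_val j)) => sv0; field.
Qed.

Lemma sum_degR_sqr_gt0 g : weighted_row g != 0 -> 0 < \sum_u d u * g u ^+ 2.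
Proof.
rewrite weighted_row_eq0 negb_forall => /existsP[u gu].
have ge0 v : 0 <= d v * g v ^+ 2 by rewrite mulr_ge0 ?sqr_ge0 ?ler0n.
rewrite (bigD1 u) //= ltr_pwDl ?sumr_ge0 //.
by rewrite mulr_gt0 ?degR_gt0 // exprn_even_gt0.
Qed.

(* The Dirichlet energy of [g] for [eps = 1], and its signless analogue for
   [eps = -1]. *)
Lemma energy g mu eps : eps ^+ 2 = 1 ->
  (forall v, \sum_(u | adj v u) g u = (1 - mu) * d v * g v) ->
  \sum_u \sum_(v | adj u v) (g u - eps * g v) ^+ 2 =
  2 * (1 - eps * (1 - mu)) * \sum_u d u * g u ^+ 2.
Proof.
move=> eps2 eig.
have sumc (c : R) u : \sum_(v | adj u v) c = d u * c.
  by rewrite sumr_const mulr_natl /degR cardsE.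
have E u : \sum_(v | adj u v) (g u - eps * g v) ^+ 2 =
    (1 - 2 * eps * (1 - mu)) * (d u * g u ^+ 2) + \sum_(v | adj u v) g v ^+ 2.
  transitivity (\sum_(v | adj u v) (g u ^+ 2 - (2 * eps * g u) * g v + g v ^+ 2)).
    by apply: eq_bigr => v _; rewrite sqrrB exprMn eps2 mul1r; ring.
  rewrite big_split sumrB /= sumc.
  rewrite (_ : \sum_(v | adj u v) _ * _ = 2 * eps * g u * \sum_(v | adj u v) g v).
    by rewrite eig; ring.
  by rewrite mulr_sumr.
rewrite (eq_bigr _ (fun u _ => E u)) big_split /= -mulr_sumr.
(* After exchanging the sums, each [g u ^+ 2] is counted once per neighbour of [u]. *)
rewrite (exchange_big_dep xpredT) //=.
have -> : \sum_u \sum_(v | adj v u) g u ^+ 2 = \sum_u d u * g u ^+ 2.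
  by apply: eq_bigr => u _; rewrite -sumc; apply: eq_bigl => v; rewrite symA.
by ring.
Qed.

(** For [eps = -1] the energy is a nonnegative sum of squares equal to [2 * (2 - mu)] times a
    positive number. *)
Lemma nlap_eigenvalue_le2 mu : eigenvalue L mu -> mu <= 2.
Proof.
case/eigenvalueP=> w; have [g ->] := weighted_rowP w.
move=> /weighted_row_nlap /(@energy _ _ (-1)) E /sum_degR_sqr_gt0 g_gt0.
have: 0 <= 2 * (1 - -1 * (1 - mu)) * \sum_u d u * g u ^+ 2.
  rewrite -E ?sqrrN ?expr1n //.
  by apply: sumr_ge0 => u _; apply: sumr_ge0 => v _; exact: sqr_ge0.
by rewrite pmulr_lge0 //; lra.
Qed.

(** At [mu = 1 - eps] the energy vanishes, and with it each of its squares. *)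
Lemma extremal_eigenvector_edge g eps u v : eps ^+ 2 = 1 ->
  weighted_row g *m L = (1 - eps) *: weighted_row g ->
  adj u v -> g u = eps * g v.
Proof.
move=> eps2 /weighted_row_nlap /(energy eps2).
rewrite (_ : 1 - eps * _ = 0); last by rewrite subKr -expr2 eps2 subrr.
rewrite mulr0 mul0r => /psumr_eq0P E uv; apply/eqP; rewrite -subr_eq0 -sqrf_eq0.
have /psumr_eq0P -> // : \sum_(v | adj u v) (g u - eps * g v) ^+ 2 = 0.
  by apply: E => // x _; apply: sumr_ge0 => y _; exact: sqr_ge0.
by move=> y _; exact: sqr_ge0.
Qed.

(** The sign function [s] gives an eigenvector. For any other one, [g * s] is constant along edges,
    hence on the whole graph, so [g] is a multiple of [s]. *)
Lemma eig_mult_extremal s eps : eps ^+ 2 = 1 -> (forall u, s u ^+ 2 = 1) ->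
  (forall u v, adj u v -> s u = eps * s v) -> eig_mult L (1 - eps) = 1%N.
Proof.
move=> eps2 s2 sE; have /card_gt0P[x0 _] : (0 < #|V|)%N by exact: ltnW.
apply: (@mup_char_poly_simple _ _ _ _ (weighted_row s)) => [||| w].
- exact: nlap_sym.
- rewrite weighted_row_eq0; apply/forallPn; exists x0.
  by rewrite -sqrf_eq0 s2 oner_neq0.
- apply/weighted_row_nlap => v; rewrite subKr.
  rewrite (eq_bigr (fun=> eps * s v)) => [|u]; last by rewrite symA => /sE.
  by rewrite sumr_const -mulr_natl /degR cardsE; ring.
have [g ->] := weighted_rowP w => eig.
have gs u : g u * s u = g x0 * s x0.
  apply: (@connected_eq _ (fun u => g u * s u)) => {}u v uv.
  rewrite (extremal_eigenvector_edge eps2 eig uv) (sE _ _ uv).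
  by rewrite mulrACA -expr2 eps2 mul1r.
exists (g x0 * s x0); apply/rowP=> i; rewrite !mxE -(gs (enum_val i)).
by rewrite mulrA -[g _ * _ * _]mulrA -expr2 s2 mulr1.
Qed.

Lemma eig_mult_nlap_0 : eig_mult L 0 = 1%N.
Proof.
rewrite -(subrr 1); apply: (@eig_mult_extremal (fun=> 1)) => *.
all: by rewrite ?expr1n ?mulr1.
Qed.

(** The boolean counts as 1 or 0. A 2-colouring yields the sign function needed for [eps = -1];
    conversely the signs of an eigenvector for 2 form a 2-colouring. *)
Lemma eig_mult_nlap_2 : eig_mult L 2 = bipartite adj.
Proof.
have E2 : 2 = 1 - -1 :> R by rewrite opprK.
case: (boolP (bipartite adj)) => [/existsP[c /forallP cP]|nbip].
  rewrite E2; apply: (@eig_mult_extremal (fun u => (-1) ^+ c u)) => [|u|u v uv].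
  - by rewrite sqrrN expr1n.
  - by rewrite sqrr_sign.
  have /forallP/(_ v)/implyP/(_ uv) := cP u.
  by case: (c u); case: (c v) => // _; rewrite !(expr0, expr1) ?mulrNN mulr1.
apply/eqP; rewrite -leqn0 leqNgt mup_char_poly_gt0; apply: contra nbip.
case/eigenvalueP=> w; have [g ->] := weighted_rowP w; rewrite {1}E2 => eig gn0.
have gE u v : adj u v -> g u = -1 * g v.
  by apply: extremal_eigenvector_edge eig; rewrite sqrrN expr1n.
have [x0 gx0] : exists x0, g x0 != 0.
  by apply/existsP; rewrite -negb_forall -weighted_row_eq0.
(* The square of [g] is constant by connectedness, so [g] has a strict sign everywhere. *)
have gx u : g u != 0.
  rewrite -sqrf_eq0 (_ : g u ^+ 2 = g x0 ^+ 2) ?sqrf_eq0 //.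
  apply: (@connected_eq _ (fun u => g u ^+ 2)) => {}u v /gE ->.
  by rewrite mulN1r sqrrN.
apply/existsP; exists [ffun u => 0 < g u]; apply/forallP=> u; apply/forallP=> v.
apply/implyP=> /gE; rewrite !ffunE => ->; rewrite mulN1r oppr_gt0.
by have := gx v; case: ltgtP.
Qed.

End NormalizedLaplacian.

(** * Incidences and degrees in the subdivision graph *)

Section Subdivision.
Variables (R : realType) (V : finType) (adj : rel V) (k : nat).
Hypotheses (simple_adj : simple_graph adj) (conn_adj : connected_graph adj).
Hypotheses (V_gt1 : (1 < #|V|)%N) (k_gt0 : (0 < k)%N).
Local Notation W := (edge_type adj * 'I_k)%type.
Local Notation S := (subdiv_adj adj k).
Local Notation d := (degR R adj).
Local Notation L := (nlap R adj).
Local Notation LS := (nlap R S).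

(** These are the entries of [D + A]. Edges at [u] correspond to its neighbours through
    [y |-> {u, y}], injective in the absence of loops; for distinct [u] and [v] only [{u, v}] can
    contain both. *)
Lemma card_common_edges u v :
  #|[set e in edge_set adj | (u \in e) && (v \in e)]| =
  (if u == v then #|[set y | adj u y]| else adj u v).
Proof.
have [symA irrA] := simple_adj.
have edgeE (e : {set V}) : u \in e -> (e \in edge_set adj) = [exists y, adj u y && (e == [set u; y])].
  move=> ue; rewrite inE; apply/existsP/existsP => [[x /existsP[y]]|[y uy]].
    case/andP=> xy /eqP Ee; move: ue; rewrite Ee !inE => /orP[] /eqP ->.
      by exists y; rewrite xy eqxx.
    by exists x; rewrite symA xy setUC eqxx.
  by exists u; apply/existsP; exists y.
have [<-{v}|uv] := eqVneq u v.
  rewrite -[RHS](@card_in_imset _ _ (fun y => [set u; y])); last first.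
    move=> y z; rewrite !inE => uy uz /setP/(_ y).
    rewrite !inE eqxx orbT => /esym/orP[] /eqP // E.
    by rewrite E irrA in uy.
  congr #|pred_of_set _|; apply/setP=> e; rewrite inE andbb.
  apply/andP/imsetP => [[Ee ue]|[y]].
    by move: Ee; rewrite edgeE // => /existsP[y /andP[uy /eqP ->]]; exists y; rewrite ?inE.
  rewrite inE => uy ->; rewrite edgeE !inE eqxx //; split=> //.
  by apply/existsP; exists y; rewrite uy eqxx.
have -> : [set e in edge_set adj | (u \in e) && (v \in e)] =
    (if adj u v then [set [set u; v]] else set0).
  apply/setP=> e; rewrite inE; apply/and3P/idP => [[]|].
    move=> + ue; rewrite edgeE // => /existsP[y /andP[uy /eqP ->]].
    by rewrite !inE [v == u]eq_sym (negbTE uv) /= => /eqP ->; rewrite uy inE.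
  case: ifP => [uv' | _]; last by rewrite inE.
  rewrite inE => /eqP ->; rewrite edgeE !inE !eqxx ?orbT //; split=> //.
  by apply/existsP; exists v; rewrite uv' eqxx.
by case: (adj u v); rewrite ?cards1 ?cards0.
Qed.

Lemma card_edge e : e \in edge_set adj -> #|e| = 2.
Proof.
rewrite inE => /existsP[x /existsP[y /andP[xy /eqP ->]]].
by rewrite cards2; case: eqVneq xy => // ->; rewrite simple_adj.2.
Qed.

Lemma sum_common_midpoints u v :
  \sum_(w : W) ((u \in val w.1) && (v \in val w.1) : nat) =
  (k * (if u == v then #|[set y | adj u y]| else adj u v))%N.
Proof.
rewrite -(pair_big xpredT xpredT
  (fun (e : edge_type adj) (_ : 'I_k) => (u \in val e) && (v \in val e) : nat)) /=.
under eq_bigr do rewrite sum_nat_const card_ord.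
rewrite -big_distrr /= -card_common_edges -sum1_card; congr (_ * _)%N.
rewrite -(big_sub (edge_set adj) (fun e => (u \in e) && (v \in e) : nat)) /=.
rewrite [RHS](eq_bigl (fun e => (e \in edge_set adj) && ((u \in e) && (v \in e)))).
  by rewrite [RHS]big_mkcondr; apply: eq_bigr => e _; case: ifP.
by move=> e; rewrite inE.
Qed.

Lemma degR_subdiv_inl u : degR R S (inl u) = k%:R * d u.
Proof.
rewrite /degR -natrM; congr _%:R; have := sum_common_midpoints u u.
rewrite eqxx => <-; rewrite -sum1_card big_mkcond big_sumType /=.
rewrite big1 ?add0n => [|x _]; last by rewrite inE.
by apply: eq_bigr => w _; rewrite inE /= andbb; case: (_ \in _).
Qed.

Lemma degR_subdiv_inr w : degR R S (inr w) = 2.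
Proof.
rewrite /degR (_ : #|_| = 2%N) //; rewrite -[RHS](card_edge (valP w.1)).
rewrite -!sum1_card big_mkcond big_sumType /= [X in (_ + X)%N]big1 => [|x _]; last first.
  by rewrite inE.
by rewrite addn0 [RHS]big_mkcond; apply: eq_bigr => x _; rewrite inE.
Qed.

(** The old-to-new block of the normalized adjacency matrix; the root is taken of the product of the
    degrees [k * d u] and 2. *)
Definition incidence_mx : 'M[R]_(#|V|, #|{: W}|) :=
  \matrix_(i < #|V|, j < #|{: W}|) ((enum_val i \in val (enum_val j).1)%:R /
                  Num.sqrt (k%:R * d (enum_val i) * 2)).
Local Notation B := incidence_mx.

Lemma mul_incidence_mxT : B *m B^T = 1%:M - 2^-1 *: L.
Proof.
have dg0 := degR_gt0 R conn_adj V_gt1.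
apply/matrixP=> i j; rewrite !mxE -/(nlap R adj) [in RHS]/=.
set u := enum_val i; set v := enum_val j.
transitivity ((\sum_(w : W) ((u \in val w.1) && (v \in val w.1) : nat))%:R /
    (Num.sqrt (k%:R * d u * 2) * Num.sqrt (k%:R * d v * 2))).
  rewrite natr_sum mulr_suml [RHS](reindex (@enum_val {: W} {: W})) /=; last first.
    exact/onW_bij/enum_val_bij.
  apply: eq_bigr => l _; rewrite !mxE -/u -/v -mulnb natrM invfM.
  by rewrite mulrACA.
have k0 : 0 < k%:R :> R by rewrite ltr0n.
rewrite sum_common_midpoints -sqrtrM; last by rewrite !mulr_ge0 // ltW.
(* The square leaves the root as [2 * k], which cancels the [k] parallel midpoints and produces the
   factor 1/2. *)
rewrite [k%:R * d u * 2 * _](_ : _ = (2 * k%:R) ^+ 2 * (d u * d v)); last by ring.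
rewrite sqrtrM ?sqr_ge0 // sqrtr_sqr ger0_norm ?mulr_ge0 // ?ltW //.
rewrite (inj_eq enum_val_inj) natrM.
have [Eij|ij] := eqVneq i j.
  rewrite /u /v Eij -expr2 sqrtr_sqr ger0_norm ?ltW //.
  rewrite /degR in dg0 *; have := lt0r_neq0 (dg0 (enum_val j)) => H.
  by have := lt0r_neq0 k0 => H2; rewrite mulr1n; field; rewrite H H2.
have: Num.sqrt (d u * d v) != 0 by rewrite gt_eqF // sqrtr_gt0 mulr_gt0.
have := lt0r_neq0 k0; rewrite -/u -/v.
by case: (adj u v) => ? ?; rewrite ?mulr1n ?mulr0n; field; apply/andP.
Qed.

(** * Block form and characteristic polynomial of the subdivided Laplacian *)

Definition subdiv_index (i : 'I_(#|V| + #|{: W}|)) : 'I_#|subdiv_type adj k| :=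
  enum_rank (match split i with
             | inl a => inl (enum_val a)
             | inr b => inr (enum_val b)
             end : subdiv_type adj k).

Lemma subdiv_index_bij : bijective subdiv_index.
Proof.
apply: inj_card_bij => [i j|]; last first.
  by rewrite !card_ord /subdiv_type card_sum.
move/enum_rank_inj => E; rewrite -[i]splitK -[j]splitK; congr unsplit.
by case: (split i) E => a; case: (split j) => b // [] /enum_val_inj ->.
Qed.

Lemma nlap_subdiv_block :
  mxsub subdiv_index subdiv_index LS = block_mx 1%:M (- B) (- B^T) 1%:M.
Proof.
apply/matrixP=> i j; rewrite mxE.
rewrite mxE (inj_eq (bij_inj subdiv_index_bij)) /subdiv_index !enum_rankK.
case: (split_ordP i) => a ->; case: (split_ordP j) => b ->.
- rewrite block_mxEul mxE (inj_eq (@lshift_inj _ _)) /=.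
  by case: eqP.
- rewrite block_mxEur eq_lrshift /=.
  rewrite degR_subdiv_inl degR_subdiv_inr !mxE.
  by case: (_ \in _); rewrite ?mul1r // mul0r oppr0.
- rewrite block_mxEdl eq_rlshift /=.
  rewrite degR_subdiv_inl degR_subdiv_inr !mxE [2 * _]mulrC.
  by case: (_ \in _); rewrite ?mul1r // mul0r oppr0.
rewrite block_mxEdr mxE (inj_eq (@rshift_inj _ _)) /=.
by case: eqP.
Qed.

(** Equal to [2 X (2 - X)]; its inverse branches are [f1] and [f2]. *)
Definition lift_poly : {poly R} := 2%:P * (1 - ('X - 1) ^+ 2).

Lemma char_poly_subdiv :
  char_poly LS * ('X - 1) ^+ #|V| =
  ((- 2^-1) ^+ #|V|)%:P * (char_poly L \Po lift_poly) * ('X - 1) ^+ #|{: W}|.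
Proof.
rewrite -(char_poly_reindex _ subdiv_index_bij) nlap_subdiv_block.
pose y : {poly R} := 'X - 1; pose pB := map_mx polyC B.
have EC : char_poly_mx (block_mx 1%:M (- B) (- B^T) 1%:M) =
    block_mx y%:M pB pB^T y%:M.
  rewrite /char_poly_mx scalar_mx_block map_block_mx !map_mxN opp_block_mx.
  by rewrite add_block_mx !opprK !add0r !map_scalar_mx -!raddfB /pB map_trmx.
rewrite /char_poly EC det_block_scalar; congr (_ * _).
have -> : (y * y)%:M - pB *m pB^T =
    (- 2^-1)%:P *: map_mx (comp_poly lift_poly) (char_poly_mx L).
  rewrite /pB map_trmx -map_mxM mul_incidence_mxT.
  apply/matrixP=> i j; move: L => M; rewrite !mxE.
  rewrite comp_polyB comp_polyC raddfMn /= comp_polyX /lift_poly /y.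
  (* The constant 1/2 is then generalized to an atom [h], of which only this relation is kept. *)
  have h2 : 2 * (2^-1)%:P = 1 :> {poly R}.
    by rewrite mulr_natl -polyCMn -[_ *+ 2]mulr_natl divff // pnatr_eq0.
  rewrite !(polyCB, polyCM, polyCN, polyCMn); move: h2.
  move: ((2^-1)%:P : {poly R}) ((M i j)%:P : {poly R}) => h m h2.
  case: (i == j); rewrite ?(mulr1n, mulr0n, polyC0, polyC1); last first.
    by rewrite !sub0r mulrNN opprK.
  transitivity (2 * h * ('X - 1) ^+ 2 - 2 * h + h * m); last by ring.
  by rewrite h2; ring.
by rewrite detZ rmorphXn /= det_map_mx.
Qed.

(** The powers of [X - 1] do not vanish at [a], and [lift_poly] minus its value at [a] is
    [-2 (X - a) (X + a - 2)], with a simple root at [a] since [a] differs from 1. *)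
Lemma eig_mult_subdiv a : a != 1 ->
  eig_mult LS a = eig_mult L (2 * (1 - (a - 1) ^+ 2)).
Proof.
move=> a1; have yn n : ~~ root (('X - 1) ^+ n : {poly R}) a.
  by rewrite /root horner_exp !hornerE expf_neq0 // subr_eq0.
rewrite /eig_mult -(mupMl _ (yn #|V|)) char_poly_subdiv mupMl // mupMr; last first.
  by rewrite rootC expf_neq0 // oppr_eq0 invr_eq0 pnatr_eq0.
have <- : lift_poly.[a] = 2 * (1 - (a - 1) ^+ 2).
  by rewrite /lift_poly hornerM hornerC !(hornerE, horner_exp).
rewrite (@mup_comp _ _ _ ((- 2)%:P * ('X + (a - 2)%:P)) _ 1) ?mul1n //.
- exact/monic_neq0/char_poly_monic.
- rewrite rootM rootC negb_or oppr_eq0 pnatr_eq0 /= /root hornerD hornerX hornerC.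
  by apply: contra a1 => /eqP E; apply/eqP; lra.
rewrite /lift_poly hornerM hornerC !(hornerE, horner_exp).
rewrite !(polyCM, polyCB, polyCD, polyCN, polyC_exp, polyC1, polyCMn).
by ring.
Qed.

(** At 1 the difference is [-2 (X - 1)^2], whence the factor 2. The additive form avoids truncated
    subtraction: [km] is [n - 1] for a tree with [k = 1]. *)
Lemma eig_mult_subdiv_1 :
  (eig_mult LS 1 + #|V| = 2 * eig_mult L 2 + #|{: W}|)%N.
Proof.
have ym n : mup 1 (('X - 1) ^+ n : {poly R}) = n by rewrite -polyC1 mup_XsubCX eqxx.
have yn n : ('X - 1) ^+ n != 0 :> {poly R}.
  by rewrite expf_neq0 // -polyC1 polyXsubC_eq0.
have cn0 n (M : 'M[R]_n) : char_poly M != 0 by exact/monic_neq0/char_poly_monic.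
have := congr1 (mup 1) char_poly_subdiv; rewrite mupM // ym -/(eig_mult _ _) => ->.
have c0 : (- 2^-1) ^+ #|V| != 0 :> R by rewrite expf_neq0 // oppr_eq0 invr_eq0 pnatr_eq0.
have E : lift_poly.[1] = 2.
  by rewrite /lift_poly hornerM hornerC !(hornerE, horner_exp) subrr expr0n subr0 mulr1.
have Em : mup 1 (char_poly L \Po lift_poly) = (2 * eig_mult L 2)%N.
  rewrite (@mup_comp _ _ _ (- 2)%:P _ 2) ?E //.
    by rewrite rootC oppr_eq0 pnatr_eq0.
  by rewrite /lift_poly !(polyCN, polyCMn, polyC1); ring.
rewrite mupM ?ym ?mupMr ?rootC ?Em //.
(* The composite is nonzero because the other side of the identity is a product of nonzero
   polynomials. *)
have := congr1 (fun p => p == 0) char_poly_subdiv.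
by rewrite !mulf_eq0 (negbTE (cn0 _ _)) !(negbTE (yn _)) !orbF /= => <-.
Qed.

Lemma card_midpoints : #|{: W}| = (k * nedges adj)%N.
Proof. by rewrite card_prod card_ord card_sig mulnC. Qed.

End Subdivision.

(** * Assembly of the spectrum of the subdivision graph *)

Theorem theorem1p1 (R : realType) (V : finType) (adj : rel V) (k : nat) :
  simple_graph adj -> connected_graph adj -> (1 < #|V|)%N -> (1 <= k)%N ->
  [/\ (forall lam : R, eigenvalue (nlap R adj) lam -> lam != 0 -> lam != 2 ->
         [/\ eigenvalue (nlap R (subdiv_adj adj k)) (f1 lam),
             eigenvalue (nlap R (subdiv_adj adj k)) (f2 lam),
             eig_mult (nlap R (subdiv_adj adj k)) (f1 lam)
               = eig_mult (nlap R adj) lam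
           & eig_mult (nlap R (subdiv_adj adj k)) (f2 lam)
               = eig_mult (nlap R adj) lam]),
      eig_mult (nlap R (subdiv_adj adj k)) 0 = 1%N,
      eig_mult (nlap R (subdiv_adj adj k)) 2 = 1%N
    & eig_mult (nlap R (subdiv_adj adj k)) 1 =
        (if bipartite adj then (k * nedges adj + 2 - #|V|)%N
         else (k * nedges adj - #|V|)%N)].
Proof.
move=> simple_adj conn_adj V_gt1 k_gt0.
have mult1 := @eig_mult_subdiv R _ _ _ simple_adj conn_adj V_gt1 k_gt0.
have m0 := @eig_mult_nlap_0 R _ _ simple_adj conn_adj V_gt1.
split.
- move=> lam eig lam0 lam2.
  have lam_lt2 : lam < 2.
    by rewrite lt_neqAle lam2 (nlap_eigenvalue_le2 simple_adj conn_adj V_gt1 eig).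
  pose r := Num.sqrt (4 - 2 * lam).
  (* Strict positivity keeps [f1 lam] and [f2 lam], which are [1 + r / 2] and [1 - r / 2], away from
     1. *)
  have r_gt0 : 0 < r by rewrite sqrtr_gt0; lra.
  have r2 : r ^+ 2 = 4 - 2 * lam by rewrite sqr_sqrtr; lra.
  have E1 : eig_mult (nlap R (subdiv_adj adj k)) (f1 lam) = eig_mult (nlap R adj) lam.
    rewrite mult1 /f1 -/r; last by rewrite gt_eqF //; lra.
    congr eig_mult; transitivity (2 - r ^+ 2 / 2); first by field.
    by rewrite r2; field.
  have E2 : eig_mult (nlap R (subdiv_adj adj k)) (f2 lam) = eig_mult (nlap R adj) lam.
    rewrite mult1 /f2 -/r; last by rewrite lt_eqF //; lra.
    congr eig_mult; transitivity (2 - r ^+ 2 / 2); first by field.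
    by rewrite r2; field.
  by split; rewrite // -mup_char_poly_gt0 -/(eig_mult _ _) ?E1 ?E2 mup_char_poly_gt0.
(* The substitution sends both 0 and 2 to the simple eigenvalue 0 of [L(G)]. *)
- rewrite mult1 ?[X in eig_mult _ X](_ : _ = 0) //; first by ring.
  by rewrite eq_sym oner_neq0.
- rewrite mult1 ?[X in eig_mult _ X](_ : _ = 0) //; first by ring.
  by rewrite gt_eqF //; lra.
have := @eig_mult_subdiv_1 R _ _ _ simple_adj conn_adj V_gt1 k_gt0.
(* Solving the additive identity shows that the natural subtraction is exact here. *)
rewrite eig_mult_nlap_2 // card_midpoints => /(canRL (addnK _)) ->.
by case: (bipartite adj); rewrite ?muln1 ?muln0 ?add0n // addnC.
Qed.
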